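(* For every constant $c>2$ there is $n_0$ such that every graph $G$ with $n \ge n_0$ vertices satisfies $\mathrm{fun}(G) \le \sqrt{c\, n \log n}$.
   Context: Here $\log$ denotes the binary logarithm. Functionality: let $G=(V,E)$ be a finite simple graph with adjacency matrix $A$. A vertex $v$ is a function of distinct vertices $u_1,\dots,u_k \in V\setminus\{v\}$ if there is a Boolean function $f:\{0,1\}^k\to\{0,1\}$ such that for every vertex $w \in V\setminus\{v,u_1,\dots,u_k\}$ we have $A[v,w] = f(A[w,u_1],\dots,A[w,u_k])$. The functionality $\mathrm{fun}_G(v)$ is the minimum $k$ such that $v$ is a function of some $k$ vertices of $G$. The functionality of $G$ is $\mathrm{fun}(G)=\max_{H}\min_{v\in V(H)} \mathrm{fun}_H(v)$, the maximum taken over all (nonempty) induced subgraphs $H$ of $G$. *)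

(* Defs.v *)
From mathcomp Require Import all_boot all_order all_algebra.
From mathcomp Require Import reals exp.

Set Implicit Arguments.
Unset Strict Implicit.
Unset Printing Implicit Defensive.

Import Order.TTheory GRing.Theory Num.Theory.

Record sgraph := SGraph {
  vertex :> finType;
  adj : rel vertex;
  adj_sym : symmetric adj;
  adj_irrefl : irreflexive adj
}.

Section Induced.
Variables (G : sgraph) (S : {set G}).

Definition induced_adj : rel {x : G | x \in S} := fun x y => adj (val x) (val y).

Lemma induced_adj_sym : symmetric induced_adj.
Proof. by move=> x y; exact: adj_sym. Qed.

Lemma induced_adj_irrefl : irreflexive induced_adj.
Proof. by move=> x; exact: adj_irrefl. Qed.

Definition induced : sgraph := SGraph induced_adj_sym induced_adj_irrefl.

End Induced.

Section VertexFunctionality.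
Variables (G : sgraph) (v : G).

Definition is_function_of (k : nat) (u : k.-tuple G) : bool :=
  [&& uniq u, v \notin u &
   [exists f : {ffun k.-tuple bool -> bool},
     [forall w : G, (w != v) && (w \notin u) ==>
       (adj v w == f [tuple adj w (tnth u i) | i < k])]]].

(* k = 0 is allowed: then f is a constant, so an isolated or a dominating
   vertex has functionality 0. *)
Definition is_function_of_some (k : nat) : bool :=
  [exists u : k.-tuple G, is_function_of u].

(* All the vertices other than v always work, as no w is left to test. *)
Lemma is_function_of_some_card : is_function_of_some #|G|.-1.
Proof.
have sz : size (enum (predC1 v)) == #|G|.-1 by rewrite -cardE cardC1.
apply/existsP; exists (Tuple sz).
apply/and3P; split; rewrite ?enum_uniq ?mem_enum ?inE ?eqxx //=.
apply/existsP; exists [ffun=> true]; apply/forallP=> w.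
by apply/implyP; rewrite mem_enum !inE => /andP[->].
Qed.

Lemma is_function_of_some_ex : exists k, is_function_of_some k.
Proof. by exists #|G|.-1; exact: is_function_of_some_card. Qed.

Definition vertex_functionality : nat := ex_minn is_function_of_some_ex.

Lemma vertex_functionality_lt : (vertex_functionality < #|G|)%N.
Proof.
have G_gt0 : (0 < #|G|)%N by apply/card_gt0P; exists v.
rewrite /vertex_functionality; case: ex_minnP => k _ /(_ _ is_function_of_some_card).
by rewrite -ltnS prednK.
Qed.

End VertexFunctionality.

(* The default value #|G| exceeds every vertex functionality, so it does not
   affect the minimum when G is nonempty (see min_functionality_attained). *)
Definition min_functionality (G : sgraph) : nat :=
  \big[minn/#|G|]_(v : G) vertex_functionality v.

Lemma min_functionality_le (G : sgraph) (v : G) :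
  (min_functionality G <= vertex_functionality v)%N.
Proof.
rewrite /min_functionality; have := mem_index_enum v.
elim: (index_enum G) => //= w r IHr; rewrite big_cons inE geq_min.
by case/predU1P=> [->|/IHr ->]; rewrite ?leqnn ?orbT.
Qed.

Lemma min_functionality_attained (G : sgraph) :
  (0 < #|G|)%N -> exists v : G, min_functionality G = vertex_functionality v.
Proof.
case/card_gt0P=> v0 _.
have [v _ vmin] := arg_minnP (@vertex_functionality G) (erefl : xpredT v0).
exists v; apply/eqP; rewrite eqn_leq min_functionality_le /=.
rewrite /min_functionality.
elim/big_ind: _ => [|m n vm vn|w _]; last exact: vmin.
  exact/ltnW/vertex_functionality_lt.
by rewrite leq_min vm vn.
Qed.

Definition functionality (G : sgraph) : nat :=
  \max_(S : {set G} | S != set0) min_functionality (induced S).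

Definition log2 {R : realType} (x : R) : R := (ln x / ln 2)%R.

(* Main.v *)
Require Import Defs.
From mathcomp Require Import all_boot all_order all_algebra.
From mathcomp Require Import reals exp.
From mathcomp Require Import sequences lra.
Import Order.TTheory GRing.Theory Num.Theory.
Local Open Scope ring_scope.

(** If some two vertices [x], [y] are separated by fewer than [K] vertices, then
    [x] is a function of [y] and of those.  Otherwise a greedy choice of [K]
    vertices separates all pairs, since each choice divides the number of
    unseparated pairs by at least [exp (K / n)] and [n ^ 2 <= exp (K ^ 2 / n)];
    every remaining vertex is a function of the chosen ones.  The condition
    [2 n ln n <= K ^ 2] leaves room for rounding [sqrt (c n log2 n)] down to an
    integer [K], because [ln 2 < 1]. *)

(** * Greedy hitting sets *)

Section Hitting.
Set Implicit Arguments.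
Unset Strict Implicit.
Local Open Scope nat_scope.

(** Double counting of the pairs [(u, p)] with [e u p]: the best [u] does at least as well as the
    average one. *)
Lemma exists_frequent_hit (T I : finType) (e : T -> pred I) (P : {set I}) (d : nat) (t0 : T) :
  (forall p, p \in P -> d <= #|[set u | e u p]|) ->
  exists u, d * #|P| <= #|T| * #|[set p in P | e u p]|.
Proof.
move=> dP.
have [u _ umax] := arg_maxnP (fun u => #|[set p in P | e u p]|) (erefl : xpredT t0).
exists u.
apply: (@leq_trans (\sum_(w : T) #|[set p in P | e w p]|)); last first.
  by rewrite -sum_nat_const; apply: leq_sum => w _; exact: umax.
have -> : \sum_(w : T) #|[set p in P | e w p]|
        = \sum_(p in P) #|[set w | e w p]|.
  transitivity (\sum_(w : T) \sum_(p in P | e w p) 1).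
    by apply: eq_bigr => w _; rewrite sum1dep_card.
  rewrite (exchange_big_dep (mem P)) /=; last by move=> w p _ /andP[].
  by apply: eq_bigr => p pP; rewrite sum1dep_card pP.
by rewrite mulnC -sum_nat_const; apply: leq_sum => p /dP.
Qed.

(** A most frequent hitter leaves at most the fraction [1 - d / #|T|] of [P] unhit, and the
    survivors still satisfy the hypothesis. Denominators are cleared to stay in [nat]. *)
Lemma greedy_hitting (T I : finType) (e : T -> pred I) (d k : nat) (P : {set I}) :
  (forall p, p \in P -> d <= #|[set u | e u p]|) ->
  exists2 U : {set T}, #|U| <= k &
    #|[set p in P | [forall u in U, ~~ e u p]]| * #|T| ^ k <= #|P| * (#|T| - d) ^ k.
Proof.
elim: k P => [|k IHk] P dP.
  exists set0; rewrite ?cards0 // !muln1 subset_leq_card //.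
  by apply/subsetP=> p; rewrite inE => /andP[].
have [t0 _|T0] := pickP (fun _ : T => true); last first.
  exists set0; first by rewrite cards0.
  by rewrite [X in X ^ _](eq_card0 T0) exp0n // muln0.
have [u hu] := @exists_frequent_hit _ _ _ _ _ t0 dP.
pose Q := [set p in P | ~~ e u p].
have [|U cU hU] := IHk Q; first by move=> p; rewrite inE => /andP[/dP].
exists (u |: U); first by rewrite cardsU1; case: (u \notin U) => //=; exact: leqW.
have -> : [set p in P | [forall w in u |: U, ~~ e w p]]
        = [set p in Q | [forall w in U, ~~ e w p]].
  apply/setP=> p; rewrite !inE -andbA; congr (_ && _).
  apply/forall_inP/andP => [H|[Hu /forall_inP HU] w].
    split; first by apply: H; rewrite setU11.
    by apply/forall_inP=> w wU; apply: H; rewrite setU1r.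
  by case/setU1P=> [->|/HU].
have cQ : #|Q| * #|T| <= #|P| * (#|T| - d).
  have -> : #|Q| = #|P| - #|[set p in P | e u p]|.
    rewrite -(cardsID [set p | e u p] P) -setIdE addKn; apply: eq_card => p.
    by rewrite !inE andbC.
  by rewrite mulnBl mulnBr leq_sub2l // mulnC [X in _ <= X]mulnC.
rewrite expnSr mulnA (leq_trans (leq_mul hU (leqnn _))) //.
by rewrite mulnAC expnS mulnA leq_mul.
Qed.

End Hitting.

(** * From separated pairs to functionality *)

Section Functionality.
Set Implicit Arguments.
Unset Strict Implicit.
Local Open Scope nat_scope.
Variable G : sgraph.
Implicit Types (v w x y u : G) (U : {set G}).

(** Trades the tuple and the Boolean function for a set and a well-definedness condition. *)
Lemma is_function_of_some_set v U :
  v \notin U ->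
  (forall w w', w != v -> w \notin U -> w' != v -> w' \notin U ->
     (forall u, u \in U -> adj w u = adj w' u) -> adj v w = adj v w') ->
  is_function_of_some v #|U|.
Proof.
move=> vU sepU; have szU : size (enum U) == #|U| by rewrite -cardE.
pose code w := [tuple adj w (tnth (Tuple szU) i) | i < #|U|].
have codeP w w' : code w = code w' -> forall u, u \in U -> adj w u = adj w' u.
  move=> eq_code u; rewrite -mem_enum => /(tnthP (Tuple szU))[i ->].
  by have := congr1 (fun t => tnth t i) eq_code; rewrite !tnth_mktuple.
apply/existsP; exists (Tuple szU); rewrite /is_function_of enum_uniq mem_enum vU /=.
apply/existsP; exists [ffun t => [exists w : G,
  [&& w != v, w \notin U, adj v w & code w == t]]].
apply/forallP=> w; apply/implyP; rewrite mem_enum => /andP[wv wU].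
rewrite ffunE; apply/eqP; apply/idP/existsP => [vw|[w' /and4P[w'v w'U vw' /eqP/codeP]]].
  by exists w; rewrite wv wU vw eqxx.
by move=> /(sepU w' w w'v w'U wv wU) <-.
Qed.

Lemma min_functionality_le_set v U K :
  #|U| <= K -> v \notin U ->
  (forall w w', w != v -> w \notin U -> w' != v -> w' \notin U ->
     (forall u, u \in U -> adj w u = adj w' u) -> adj v w = adj v w') ->
  min_functionality G <= K.
Proof.
move=> cU vU /(is_function_of_some_set vU) vf.
apply: leq_trans (min_functionality_le v) _; apply: leq_trans _ cU.
by rewrite /vertex_functionality; case: ex_minnP => k _; exact.
Qed.

Definition separators (p : G * G) : {set G} := [set u | adj p.1 u != adj p.2 u].

(** Away from these vertices [x] and [y] have the same neighbours, so the Boolean function just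
    reads the bit at [y]. If [x] and [y] are adjacent, [x] itself is a separator and must be removed
    from the arguments. *)
Lemma min_functionality_le_separators x y K :
  x != y -> #|separators (x, y)| < K -> min_functionality G <= K.
Proof.
move=> xy cD; apply: (@min_functionality_le_set x (y |: separators (x, y) :\ x)).
- rewrite cardsU1; apply: leq_trans cD.
  by rewrite (leq_add (leq_b1 _)) // subset_leq_card // subD1set.
- by rewrite !inE eqxx orbF.
- have twin w : w != x -> w \notin y |: separators (x, y) :\ x -> adj x w = adj w y.
    move=> wx; rewrite !inE wx negb_or /= negbK => /andP[_ /eqP->].
    exact: adj_sym.
  move=> w w' wx wU w'x w'U sep.
  by rewrite (twin w) // (twin w') //; apply: sep; rewrite setU11.
Qed.

Lemma min_functionality_le_greedy K :
  K < #|G| -> #|G| ^ 2 * (#|G| - K) ^ K <= #|G| ^ K -> min_functionality G <= K.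
Proof.
move=> KG hK; have G_gt0 : 0 < #|G| by apply: leq_ltn_trans KG.
case: (boolP [exists p : G * G, (p.1 != p.2) && (#|separators p| < K)]).
  case/existsP=> -[x y] /andP[xy]; exact: min_functionality_le_separators.
move=> noclose; pose P := [set p : G * G | p.1 != p.2].
(* [K] is both the least number of separators of a pair and the number of greedy choices. *)
have [p|U cU hU] := @greedy_hitting G (G * G)%type (fun u p => u \in separators p) K K P.
  rewrite inE => np; rewrite leqNgt; apply: contra noclose => cp.
  apply/existsP; exists p; rewrite np; apply: leq_trans _ cp.
  by rewrite ltnS subset_leq_card //; apply/subsetP=> u; rewrite !inE.
(* The missing diagonal makes this strict, so that fewer than one unseparated pair remains. *)
have cP : #|P| < #|G| ^ 2.
  have [v _] := card_gt0P G_gt0.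
  rewrite -mulnn -card_prod -cardsT; apply: proper_card.
  by apply/properP; split; [exact: subsetT | exists (v, v); rewrite ?inE ?eqxx].
have sep0 : #|[set p in P | [forall u in U, u \notin separators p]]| = 0.
  apply/eqP; rewrite -leqn0 -ltnS -(ltn_pmul2r (m := #|G| ^ K)); last by rewrite expn_gt0 G_gt0.
  rewrite mul1n; apply: leq_ltn_trans hU _; apply: leq_trans _ hK.
  by rewrite ltn_pmul2r // expn_gt0 subn_gt0 KG.
have [v vU] : exists v, v \notin U.
  apply/existsP; rewrite -negb_forall; apply: contraL (leq_ltn_trans cU KG).
  move=> /forallP UT; rewrite -leqNgt -cardsT subset_leq_card //.
  by apply/subsetP=> w _; exact: UT.
(* Any [v] outside [U] works: vertices that agree on [U] are equal. *)
apply: (min_functionality_le_set cU vU) => w w' _ _ _ _ eqU.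
have [-> //|ww'] := eqVneq w w'.
have /setP/(_ (w, w')) := cards0_eq sep0.
rewrite !inE /= ww' /= => /negP[]; apply/forall_inP=> u uU.
by rewrite inE negbK /= eqU.
Qed.

End Functionality.

(** * Real estimates *)

Section Estimates.
Set Implicit Arguments.
Unset Strict Implicit.
Variable R : realType.

(** With [1 - x <= expR (- x)], the power [(1 - K / m) ^ K] is at most [expR (- K ^ 2 / m)], hence
    at most [m ^ -2]. *)
Lemma greedy_estimate (m K : nat) : (K < m)%N ->
  2 * m%:R * ln m%:R <= K%:R ^+ 2 :> R -> (m ^ 2 * (m - K) ^ K <= m ^ K)%N.
Proof.
move=> Km hK; have m_gt0 : 0 < m%:R :> R by rewrite ltr0n (leq_ltn_trans _ Km).
rewrite -(ler_nat R) natrM !natrX natrB ?(ltnW Km) //.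
have -> : m%:R - K%:R = m%:R * (1 - K%:R / m%:R) :> R.
  by rewrite mulrBr mulr1 mulrCA divff ?mulr1 // gt_eqF.
rewrite exprMn mulrCA ger_pMr ?exprn_gt0 //.
have b_ge0 : 0 <= 1 - K%:R / m%:R :> R.
  by rewrite subr_ge0 ler_pdivrMr // mul1r ler_nat ltnW.
have decay : (1 - K%:R / m%:R) ^+ K <= expR (- (2 * ln m%:R)) :> R.
  apply: (@le_trans _ _ (expR (- (K%:R / m%:R)) ^+ K)).
    by rewrite lerXn2r ?nnegrE ?expR_ge0 // expR_ge1Dx.
  rewrite -expRM_natl ler_expR mulrN lerN2 mulrA -expr2 ler_pdivlMr //.
  by rewrite mulrAC.
have -> : m%:R ^+ 2 = expR (2 * ln m%:R) :> R.
  by rewrite expRM_natl lnK ?posrE.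
by rewrite -[leRHS](expRxMexpNx_1 (2 * ln m%:R)) ler_wpM2l // expR_ge0.
Qed.

Lemma min_functionality_bound (G : sgraph) (K : nat) :
  2 * #|G|%:R * ln #|G|%:R <= K%:R ^+ 2 :> R -> (min_functionality G <= K)%N.
Proof.
have [GK _|KG hK] := leqP #|G| K.
  (* The default value [#|G|] of the minimum already bounds it. *)
  apply: leq_trans GK; elim/big_rec: (min_functionality G) => // v k _.
  by rewrite geq_min orbC => ->.
exact: (min_functionality_le_greedy KG (greedy_estimate KG hK)).
Qed.

(** As [m * ln m] increases for [m >= 1], one [K] serves all induced subgraphs. *)
Lemma functionality_bound (G : sgraph) (K : nat) :
  2 * #|G|%:R * ln #|G|%:R <= K%:R ^+ 2 :> R -> (functionality G <= K)%N.
Proof.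
move=> hK; apply/bigmax_leqP => S /set0Pn[x xS].
apply: min_functionality_bound; apply: le_trans hK.
have SG : (#|induced S| <= #|G|)%N.
  by rewrite card_sig max_card.
have S_gt0 : (0 < #|induced S|)%N by apply/card_gt0P; exists (exist _ x xS).
have G_gt0 := leq_trans S_gt0 SG.
apply: ler_pM; rewrite ?mulr_ge0 ?ln_ge0 ?ler1n //.
  by rewrite ler_pM2l // ler_nat.
by rewrite ler_ln ?posrE ?ltr0n // ler_nat.
Qed.

Lemma ln2_le : ln 2 <= 4 / 5 :> R.
Proof.
rewrite -ler_expR lnK ?posrE // expRM_natl.
(* Here [expR (1 / 5) >= 6 / 5], and [(6 / 5) ^ 4 = 2.0736]. *)
apply: (@le_trans _ _ ((1 + 5^-1) ^+ 4)); first by lra.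
by rewrite lerXn2r ?nnegrE ?expR_ge0 ?expR_ge1Dx //; lra.
Qed.

End Estimates.

Theorem theorem2 (R : realType) (c : R) (hc : 2 < c) :
  exists n0 : nat, forall G : sgraph, (n0 <= #|G|)%N ->
    (functionality G)%:R <= Num.sqrt (c * #|G|%:R * log2 #|G|%:R).
Proof.
exists 16%N => G; set n := #|G| => n16.
set s := Num.sqrt _; have s_ge0 : 0 <= s by exact: sqrtr_ge0.
have ln2_gt0 : 0 < ln 2 :> R by rewrite ln_gt0 // ltr1n.
have n_ge : 16 <= n%:R :> R by rewrite ler_nat.
have log_ge : 4 <= log2 n%:R :> R.
  rewrite /log2 ler_pdivlMr // mulr_natl -lnXn //.
  by rewrite ler_ln ?posrE ?exprn_gt0 //; lra.
have nlog : 64 <= n%:R * log2 n%:R :> R by nra.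
have sE : s ^+ 2 = c * n%:R * log2 n%:R.
  by rewrite sqr_sqrtr // -mulrA mulr_ge0 //; lra.
have lnE : ln n%:R = log2 n%:R * ln 2 :> R by rewrite /log2 divfK // gt_eqF.
have s2 : 2 * (n%:R * log2 n%:R) <= s ^+ 2 by rewrite sE -mulrA ler_wpM2r //; lra.
(* From [s ^ 2 >= 128]. Then [s - 1 >= 9 / 10 * s], so [(s - 1) ^ 2 >= 81 / 100 * s ^ 2], which
   beats the factor [4 / 5] bounding [ln 2]. *)
have s_ge : 10 <= s by nra.
have /andP[Ks sK] := truncn_itv s_ge0.
apply: le_trans Ks; rewrite ler_nat; apply: (@functionality_bound R).
have ln2_le := ln2_le R.
have K_ge : s - 1 <= (Num.truncn s)%:R by move: sK; rewrite -natr1; lra.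
apply: (@le_trans _ _ ((s - 1) ^+ 2)); last first.
  by rewrite lerXn2r ?nnegrE ?ler0n //; lra.
rewrite -/n lnE; nra.
Qed.
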